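(* There exists $\Delta_0$ such that, if $\mathcal{H}$ is a $3$-uniform hypergraph with maximum degree $\Delta>\Delta_0$ and $q\geq 1.65\,\Delta$, then the Markov chain $\mathcal{C}(\mathcal{H})$ (the Glauber dynamics on proper $q$-colourings of $\mathcal{H}$) mixes rapidly.
   Context: A hypergraph $\mathcal{H}=(\mathcal{V},\mathcal{E})$ has a finite vertex set $\mathcal{V}$ and edges that are subsets of $\mathcal{V}$; it is $3$-uniform if every edge has exactly $3$ vertices. The degree of a vertex is the number of edges containing it. A $q$-colouring $\mathcal{V}\to\{1,\dots,q\}$ ($q$ a positive integer) is proper if no edge is monochromatic. Let $\Omega'(\mathcal{H})$ be the set of all proper $q$-colourings of $\mathcal{H}$. The Markov chain $\mathcal{C}(\mathcal{H})$ has state space $\Omega'(\mathcal{H})$ and the following transitions from $X_t$: select a vertex $v\in\mathcal{V}$ and a colour $k\in\{1,\dots,q\}$ uniformly at random; let $X'_t$ be the colouring obtained from $X_t$ by recolouring $v$ with colour $k$; if $X'_t$ is proper let $X_{t+1}=X'_t$, otherwise let $X_{t+1}=X_t$. Its stationary distribution $\pi$ is uniform on $\Omega'(\mathcal{H})$. The mixing time is $\tau(\varepsilon)=\min\{t:\max_x d_{TV}(P^{t'}(x,\cdot),\pi)\le\varepsilon\ \text{for all }t'\ge t\}$, where $P$ is the transition matrix and $d_{TV}$ is total variation distance. ''Mixes rapidly'' means that $\tau(\varepsilon)$ is bounded by a fixed polynomial in $n=|\mathcal{V}|$ and $\log(1/\varepsilon)$. *)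

(* Defs.v *)
From HB Require Import structures.
From mathcomp Require Import all_boot all_order all_algebra.
From mathcomp Require Import reals exp.

Set Implicit Arguments.
Unset Strict Implicit.
Unset Printing Implicit Defensive.

Import Order.TTheory GRing.Theory Num.Theory.
Local Open Scope ring_scope.

Definition hypergraph (V : finType) := {set {set V}}.

Definition uniform (k : nat) (V : finType) (H : hypergraph V) : Prop :=
  forall e, e \in H -> #|e| = k.

Definition degree (V : finType) (H : hypergraph V) (v : V) : nat :=
  #|[set e in H | v \in e]|.

Definition max_degree (V : finType) (H : hypergraph V) : nat :=
  (\max_(v : V) degree H v)%N.

Section Colourings.
Variables (V : finType) (H : hypergraph V) (q : nat).

Definition colouring := {ffun V -> 'I_q}.

Definition monochromatic (f : colouring) (e : {set V}) : bool :=
  [exists k : 'I_q, [forall v in e, f v == k]].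

Definition proper (f : colouring) : bool :=
  [forall e in H, ~~ monochromatic f e].

Definition proper_colouring := {f : colouring | proper f}.

Definition recolour (f : colouring) (v : V) (k : 'I_q) : colouring :=
  [ffun u => if u == v then k else f u].

(* [insubd X f] is [f] as a proper colouring if [f] is proper, and [X]
   otherwise. *)
Definition glauber_step (X : proper_colouring) (v : V) (k : 'I_q) :
    proper_colouring :=
  insubd X (recolour (val X) v k).

End Colourings.

Section MarkovChains.
Variables (R : realType) (S : finType).

Definition tv_dist (mu nu : S -> R) : R :=
  2^-1 * \sum_(x : S) `|mu x - nu x|.

Definition uniform_dist : S -> R := fun=> #|S|%:R^-1.

(* The t-step transition probabilities, as entries of the t-th power of the
   transition matrix (rows and columns indexed by the enumeration of S). *)
Definition step_prob (P : S -> S -> R) (t : nat) (x y : S) : R :=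
  ((\matrix_(i < #|S|, j < #|S|) P (enum_val i) (enum_val j)) ^+ t)
    (enum_rank x) (enum_rank y).

(* Distances are nonnegative, so 0 is a neutral default for the maximum. *)
Definition worst_tv_dist (P : S -> S -> R) (pi : S -> R) (t : nat) : R :=
  \big[Num.max/0]_(x : S) tv_dist (step_prob P t x) pi.

Definition mixed_from (P : S -> S -> R) (pi : S -> R) (eps : R) (t : nat) :
    Prop :=
  forall t', (t <= t')%N -> worst_tv_dist P pi t' <= eps.

(* The minimum in the definition of the mixing time is taken over a set that
   may be empty for a general chain, hence a relation. *)
Definition is_mixing_time (P : S -> S -> R) (pi : S -> R) (eps : R)
    (tau : nat) : Prop :=
  mixed_from P pi eps tau /\
  forall t, mixed_from P pi eps t -> (tau <= t)%N.

End MarkovChains.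

Definition glauber (R : realType) (V : finType) (H : hypergraph V) (q : nat)
    (x y : proper_colouring H q) : R :=
  #|[set vk : V * 'I_q | glauber_step x vk.1 vk.2 == y]|%:R / (#|V| * q)%:R.

(* Main.v *)
Require Import Defs.
From HB Require Import structures.
From mathcomp Require Import all_boot all_order all_algebra.
From mathcomp Require Import boolp reals sequences exp.
From mathcomp Require Import zify ring lra.

Set Implicit Arguments.
Unset Strict Implicit.
Unset Printing Implicit Defensive.

Import Order.TTheory GRing.Theory Num.Theory.
Local Open Scope ring_scope.

(** Path coupling with the identity coupling and a non-Hamming metric. If the
    proper colourings X and Y differ only at w, call an edge {w, u, v} crossed
    if u and v carry the two colours X w and Y w. Only a crossed edge can spread
    the disagreement in two ways, and any recolouring of u or v is likely to
    uncross it, so the pair (X, Y) is given weight 2 Delta + N, where N is the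
    number of crossed edges, and its expected weight shrinks by the factor
    1 - 1/(50 n) in every step once q >= 1.65 Delta and Delta > 40. The coupling
    is used in dual form: a function on proper colourings which is Lipschitz for
    these weights becomes more so under the transition operator. Finally any two
    proper colourings are joined by n (n + 1) single-vertex recolourings through
    proper colourings, which turns the local contraction into a bound on the
    total variation distance. *)

(** * Blocked colours, links and crossed edges *)

Section Geometry.
Variables (V : finType) (H : hypergraph V) (q : nat).
Hypothesis H3 : uniform 3 H.
Local Notation Omega := (proper_colouring H q).
Local Notation Delta := (max_degree H).
Implicit Types (X Y Z : Omega) (u v w : V) (k c : 'I_q).

Definition allowed X v k : bool := Defs.proper H (recolour (sval X) v k).

Definition agree_off X Y w := forall u, u != w -> sval X u = sval Y u.

Lemma degree_le_max v : (degree H v <= Delta)%N.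
Proof. exact: (leq_bigmax v). Qed.

Lemma not_monochromatic X e c : e \in H -> {in e, forall y, sval X y = c} -> False.
Proof.
move=> eH eC; have := valP X => /forallP/(_ e); rewrite eH /=.
move/existsPn/(_ c)/negP; apply; apply/forallP => y; apply/implyP => ye.
by rewrite eC.
Qed.

(** Since [X] is proper, an edge that the recolouring makes monochromatic must contain [v]. *)
Lemma not_allowedP X v k :
  reflect (exists e, [/\ e \in H, v \in e &
             forall y, y \in e -> y != v -> sval X y = k]) (~~ allowed X v k).
Proof.
apply: (iffP idP) => [|[e [eH ve eC]]].
  case/forallPn => e; rewrite negb_imply negbK => /andP[eH /existsP[c /forallP ec]].
  have ec' y : y \in e -> recolour (sval X) v k y = c.
    by move=> ye; have := ec y; rewrite ye => /eqP.
  have ve : v \in e.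
    apply/negPn/negP => vNe; apply: (@not_monochromatic X e c eH) => y ye.
    by have := ec' y ye; rewrite ffunE; case: eqVneq => // yv; rewrite -yv ye in vNe.
  exists e; split=> // y ye yv; have := ec' v ve; rewrite ffunE eqxx => ->.
  by have := ec' y ye; rewrite ffunE (negPf yv).
apply/forallPn; exists e; rewrite negb_imply eH negbK /=.
apply/existsP; exists k; apply/forallP => y; apply/implyP => ye; rewrite ffunE.
by case: (eqVneq y v) => [_|/(eC y ye)/eqP].
Qed.

Lemma val_step X v k : sval (glauber_step X v k) =
  if allowed X v k then recolour (sval X) v k else sval X.
Proof. by rewrite /glauber_step val_insubd. Qed.

Lemma step_allowed X v k u : allowed X v k ->
  sval (glauber_step X v k) u = if u == v then k else sval X u.
Proof. by move=> a; rewrite val_step a ffunE. Qed.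

Lemma step_not_allowed X v k : ~~ allowed X v k -> glauber_step X v k = X.
Proof. by move=> a; apply: val_inj; rewrite /= val_step (negPf a). Qed.

(** Charge each such colour to an edge at [u]: its vertex outside [u] and [w] carries that colour in
    both colourings. One edge thus accounts for one colour, and [X] and [Y] together lose at most
    [Delta], not [2 * Delta]. *)
Lemma card_not_allowed X Y w u : agree_off X Y w ->
  (#|[set k | ~~ (allowed X u k && allowed Y u k)]| <= Delta)%N.
Proof.
(* The default [u] is never reached on edges of [H]: three vertices do not fit into [[set u; w]]. *)
move=> XY; pose g (e : {set V}) := sval X (odflt u [pick y in e :\: [set u; w]]).
apply: leq_trans (degree_le_max u); apply: leq_trans (leq_imset_card g _).
apply/subset_leq_card/subsetP => k; rewrite inE negb_and => bad.
have [e [eH ue eC]] : exists e, [/\ e \in H, u \in e &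
    forall y, y \in e -> y != u -> y != w -> sval X y = k].
  case/orP: bad => /not_allowedP[e [eH ue eC]]; exists e; split=> // y ye yu yw.
    exact: eC.
  by rewrite XY // eC.
apply/imsetP; exists e; first by rewrite inE eH.
rewrite /g; case: pickP => [y|none] /=.
  by rewrite !inE negb_or => /andP[/andP[yu yw] ye]; rewrite eC.
have : (#|e| <= #|[set u; w]|)%N.
  apply/subset_leq_card/subsetP => y ye; have := none y.
  by rewrite in_setD ye andbT => /negbFE.
by rewrite H3 // cards2; case: (u != w).
Qed.

Lemma card_both_allowed X Y w u c : agree_off X Y w ->
  (q - Delta - 1 <= #|[set k | [&& allowed X u k, allowed Y u k & k != c]]|)%N.
Proof.
move=> XY; have := card_not_allowed u XY; set B := [set k | ~~ _].
have : (#|~: (B :|: [set c])| <= #|[set k | [&& allowed X u k, allowed Y u k & k != c]]|)%N.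
  apply/subset_leq_card/subsetP => k.
  by rewrite !inE negb_or negbK -andbA.
have := cardsC (B :|: [set c]); rewrite card_ord.
have := leq_card_setU B [set c]; rewrite cards1 => -[h _].
move: h; lia.
Qed.

(** The link of [w] as ordered pairs: each edge at [w] occurs twice, whence the factors 2 below. *)
Definition links w : {set V * V} := [set p | [set w; p.1; p.2] \in H].

Lemma linksP w p : p \in links w -> [/\ p.1 != w, p.2 != w & p.1 != p.2].
Proof.
case: p => u v; rewrite inE /= => /H3.
rewrite -setUA cardsU1 cards2 !inE negb_or !(eq_sym w).
by case: (u == w); case: (v == w); case: (u == v).
Qed.

Lemma links_sym w u v : ((u, v) \in links w) = ((v, u) \in links w).
Proof. by rewrite !inE /= -!setUA (setUC [set u]). Qed.

Lemma edge_links e w v : e \in H -> w \in e -> v \in e -> v != w ->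
  exists u, [/\ u \in e, (u, v) \in links w & u != v].
Proof.
move=> eH we ve vw.
have wv : w != v by rewrite eq_sym.
have sub : [set w; v] \subset e by apply/subsetP => y /set2P[]->.
have : #|e :\: [set w; v]| == 1%N.
  by rewrite cardsD (setIidPr sub) H3 // cards2 wv.
case/cards1P => u eu.
have : u \in e :\: [set w; v] by rewrite eu set11.
rewrite !inE negb_or => /andP[/andP[uw uv] ue]; exists u; split=> //.
rewrite inE /=; suff -> : [set w; u; v] = e by [].
by rewrite -setUA (setUC [set u]) setUA -eu -{2}(setID e [set w; v]) (setIidPr sub).
Qed.

Lemma card_links w : (#|links w| <= 2 * Delta)%N.
Proof.
apply: leq_trans (_ : 2 * degree H w <= _)%N; last by rewrite leq_mul2l degree_le_max.
pose g (p : V * V) := [set w; p.1; p.2].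
rewrite -sum1_card (partition_big g (fun e => e \in [set e in H | w \in e])) /=; last first.
  by move=> p; rewrite !inE eqxx => ->.
rewrite mulnC -sum_nat_const; apply: leq_sum => e; rewrite inE => /andP[eH we].
rewrite sum1dep_card /=.
have e2 : #|e :\ w| = 2%N.
  by have := cardsD1 w e; rewrite we H3 //; lia.
have /cards2P[x [y [xy exy]]] : #|e :\ w| == 2%N by rewrite e2.
apply: leq_trans (_ : #|[set (x, y); (y, x)]| <= _)%N; last by rewrite cards2; case: (_ != _).
apply/subset_leq_card/subsetP => -[u v]; rewrite !inE /= => /andP[lk /eqP guv].
have /linksP[/= uw vw uv] : (u, v) \in links w by rewrite inE.
have : u \in e :\ w by rewrite -guv !inE uw eqxx /= orbT.
have : v \in e :\ w by rewrite -guv !inE vw eqxx /= !orbT.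
rewrite exy => /set2P[] ev /set2P[] eu; move: uv; rewrite eu ev ?eqxx ?orbT //.
Qed.

(** The order of the colours is prescribed, so a crossed edge is counted once when [sval X w] and
    [sval Y w] differ. *)
Definition crossed X Y w : {set V * V} :=
  [set p in links w | (sval X p.1 == sval X w) && (sval X p.2 == sval Y w)].

Lemma in_crossed X Y w p : (p \in crossed X Y w) =
  (p \in links w) && ((sval X p.1 == sval X w) && (sval X p.2 == sval Y w)).
Proof. by rewrite [in LHS]in_set. Qed.

Definition weight X Y w : nat := (2 * Delta + #|crossed X Y w|)%N.

Definition discordant X Y w : {set V * 'I_q} :=
  [set p | (p.1 != w) && (allowed X p.1 p.2 != allowed Y p.1 p.2)].

Definition concordant X Y w : {set V * 'I_q} :=
  [set p | [&& p.1 != w, allowed X p.1 p.2 & allowed Y p.1 p.2]].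

Definition swap_pair (p : V * V) := (p.2, p.1).

Lemma swap_pairK : involutive swap_pair. Proof. by case. Qed.

Lemma links_swap w p : (swap_pair p \in links w) = (p \in links w).
Proof. by case: p => u v; rewrite links_sym. Qed.

(** * Counting moves for two colourings that differ exactly at [w] *)

Section Pair.
Variables (X Y : Omega) (w : V).
Hypothesis (XY : agree_off X Y w) (XYw : sval X w != sval Y w).

Let hit (u : V) := (sval X u == sval X w) || (sval X u == sval Y w).

(** A discordant move [(v, k)] comes from an edge through [w], [v] and some [u] of colour [k] that
    matches [w] in the colouring rejecting the move. Hence [(u, v)] determines the move. *)
Lemma card_discordant : (#|discordant X Y w| <= \sum_(p in links w) hit p.1)%N.
Proof.
have -> : (\sum_(p in links w) hit p.1 = #|[set p in links w | hit p.1]|)%N.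
  by rewrite -sum1dep_card big_mkcondr /=; apply: eq_bigr => p _; case: (hit _).
apply: leq_trans (leq_imset_card (fun p => (p.2, sval X p.1)) _).
apply/subset_leq_card/subsetP => -[v k]; rewrite inE /= => /andP[vw bad].
have key (A B : Omega) : agree_off A B w -> ~~ allowed A v k -> allowed B v k ->
    exists u, [/\ (u, v) \in links w, sval A u = sval A w & sval A u = k].
  move=> AB /not_allowedP[e [eH ve eC]] aB.
  (* An edge avoiding [w] would block [k] in [B] as well. *)
  have we : w \in e.
    apply: contraLR aB => wNe; apply/not_allowedP; exists e; split=> // y ye yv.
    by rewrite -AB ?eC //; apply: contraNneq wNe => <-.
  have [u [ue lk uv]] := edge_links eH we ve vw.
  by exists u; rewrite !eC // eq_sym.
have YX : agree_off Y X w by move=> u uw; rewrite XY.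
have [u lk [hu ku]] : exists2 u, (u, v) \in links w & hit u /\ sval X u = k.
  case aX : (allowed X v k) bad; case aY : (allowed Y v k) => //= _.
    have [u [lk e1 e2]] := key _ _ YX (negbT aY) aX.
    have [/= uw _ _] := linksP lk.
    by exists u => //; rewrite /hit XY // e1 eqxx orbT -e1.
  have [u [lk e1 e2]] := key _ _ XY (negbT aX) aY.
  by exists u => //; rewrite /hit e1 eqxx -e1.
by apply/imsetP; exists (u, v); [apply/setIdP | rewrite /= ku].
Qed.

(** A colour blocked at [w] is carried by both other vertices of some edge, which contributes both
    of its orderings. *)
Lemma card_blocked :
  (2 * #|[set k | ~~ allowed X w k]| <= \sum_(p in links w) (sval X p.1 == sval X p.2))%N.
Proof.
rewrite mulnC -sum_nat_const.
have -> : (\sum_(p in links w) (sval X p.1 == sval X p.2) =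
    \sum_(k : 'I_q) \sum_(p in links w) ((sval X p.1 == k) && (sval X p.2 == k)))%N.
  rewrite exchange_big /=; apply: eq_bigr => p _.
  rewrite (bigD1 (sval X p.1)) //= eqxx eq_sym big1 ?addn0 // => k.
  by rewrite eq_sym => /negPf->.
rewrite big_mkcond; apply: leq_sum => k _; rewrite inE; case: ifP => // /not_allowedP.
case=> e [eH we eC].
have : (0 < #|e :\ w|)%N by have := cardsD1 w e; rewrite we H3 //; lia.
case/card_gt0P => v /setD1P[vw ve].
have [u [ue lk uv]] := edge_links eH we ve vw; have [/= uw _ _] := linksP lk.
have -> : 2%N = #|[set (u, v); (v, u)]| by rewrite cards2 xpair_eqE negb_and uv.
rewrite -sum1_card big_mkcond [leqRHS]big_mkcond /=; apply: leq_sum => p _.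
case: ifP => // /set2P[]->; rewrite -?(links_sym w u v) lk /=.
  by rewrite (eC u) // (eC v) // eqxx.
by rewrite (eC u) // (eC v) // eqxx.
Qed.

Lemma sum_links_swap (F : V * V -> nat) :
  (\sum_(p in links w) F (swap_pair p) = \sum_(p in links w) F p)%N.
Proof.
rewrite [RHS](reindex_inj (inv_inj swap_pairK)); apply: eq_bigl => p.
by rewrite links_swap.
Qed.

Lemma card_crossed :
  #|crossed X Y w| = (\sum_(p in links w)
     ((sval X p.1 == sval X w) && (sval X p.2 == sval Y w)))%N.
Proof.
rewrite -sum1_card big_mkcond [RHS]big_mkcond /=.
by apply: eq_bigr => p _; rewrite in_crossed; case: (p \in links w) => //=; case: (_ && _).
Qed.

(* Over ordered neighbour pairs: a pair spreads the disagreement from both of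
   its entries only if it is crossed, and from neither if it blocks a colour
   at [w]. *)
Lemma discordant_blocked :
  (#|discordant X Y w| + #|[set k | ~~ allowed X w k]| <= Delta + #|crossed X Y w|)%N.
Proof.
have pointwise p : p \in links w ->
    (hit p.1 + hit p.2 + (sval X p.1 == sval X p.2) <=
     1 + ((sval X p.1 == sval X w) && (sval X p.2 == sval Y w)) +
         ((sval X p.2 == sval X w) && (sval X p.1 == sval Y w)))%N.
  move=> lk; have [uw vw uv] := linksP lk; rewrite inE in lk.
  (* Properness of [X] and of [Y] excludes link pairs with both entries coloured [sval X w], or both
     [sval Y w]. *)
  have noX : ~~ ((sval X p.1 == sval X w) && (sval X p.2 == sval X w)).
    apply/negP => /andP[/eqP e1 /eqP e2].
    apply: (@not_monochromatic X _ (sval X w) lk) => y.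
    by rewrite !inE -orbA => /or3P[] /eqP->.
  have noY : ~~ ((sval X p.1 == sval Y w) && (sval X p.2 == sval Y w)).
    apply/negP => /andP[/eqP e1 /eqP e2].
    apply: (@not_monochromatic Y _ (sval Y w) lk) => y.
    by rewrite !inE -orbA => /or3P[] /eqP-> //; rewrite -XY.
  move: noX noY; rewrite /hit; case: (eqVneq (sval X p.1) (sval X p.2)) => [->|_].
    by do 2 case: (_ == _).
  case: (eqVneq (sval X p.1) (sval X w)) => [->|_] /=; first rewrite (negPf XYw) /=.
    by case: (eqVneq (sval X p.2) (sval X w)) => //=; case: (_ == _).
  case: (eqVneq (sval X p.2) (sval X w)) => [->|_] /=; first rewrite (negPf XYw) /=.
    by case: (_ == _).
  by do 2 case: (_ == _).
(* By symmetry of the link, both [hit] sums agree and both crossing sums agree; the total is twice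
   the claim. *)
have := leq_sum (index_enum _) pointwise; rewrite !big_split /= sum1_card.
have := sum_links_swap (fun p => hit p.1); rewrite /= => ->.
have := sum_links_swap (fun p => ((sval X p.1 == sval X w) && (sval X p.2 == sval Y w) : nat)).
rewrite /= => ->; rewrite -card_crossed.
have := card_discordant; have := card_blocked; have := card_links w.
set s := (\sum_(p in links w) hit p.1)%N.
set t := (\sum_(p in links w) (sval X p.1 == sval X p.2))%N.
move: s t #|_| #|discordant _ _ _| #|_| #|crossed _ _ _| => s t a b c d; lia.
Qed.

(** A concordant move leaves [w] alone, so the two reference colours stay the same. *)
Lemma crossed_step p v k : (v, k) \in concordant X Y w -> p \in links w ->
  (p \in crossed (glauber_step X v k) (glauber_step Y v k) w) =
  ((if p.1 == v then k else sval X p.1) == sval X w) &&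
  ((if p.2 == v then k else sval X p.2) == sval Y w).
Proof.
rewrite inE /= => /and3P[vw aX aY] lk; rewrite in_crossed lk !step_allowed //.
by rewrite !(eq_sym w) (negPf vw).
Qed.

(* A crossed pair is uncrossed by almost every allowed recolouring of either
   of its vertices, an uncrossed one is crossed by at most two moves. *)
Lemma crossed_pair_drift p : p \in links w ->
  (\sum_(vk in concordant X Y w)
     (p \in crossed (glauber_step X vk.1 vk.2) (glauber_step Y vk.1 vk.2) w) +
   2 * (q - Delta - 1) * (p \in crossed X Y w) <=
   #|concordant X Y w| * (p \in crossed X Y w) + 2)%N.
Proof.
case: p => u v lk; have [/= uw vw uv] := linksP lk.
have pC : ((u, v) \in crossed X Y w) = (sval X u == sval X w) && (sval X v == sval Y w).
  by rewrite in_crossed lk.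
have sumE : (\sum_(vk in concordant X Y w)
     ((u, v) \in crossed (glauber_step X vk.1 vk.2) (glauber_step Y vk.1 vk.2) w) =
   #|[set vk in concordant X Y w |
      ((if u == vk.1 then vk.2 else sval X u) == sval X w) &&
      ((if v == vk.1 then vk.2 else sval X v) == sval Y w)]|)%N.
  rewrite -sum1dep_card [RHS]big_mkcondr /=; apply: eq_bigr => -[x k] xk.
  by rewrite crossed_step //=; case: (_ && _).
rewrite {}sumE {}pC.
set A := [set vk in concordant X Y w | _].
case: (boolP (_ && _)) => [/andP[/eqP Xu /eqP Xv]|nc].
  (* The concordant moves that give [u] or [v] a new colour; all of them uncross the pair. *)
  pose Z := [set (u, k) | k in [set k | [&& allowed X u k, allowed Y u k & k != sval X w]]]
       :|: [set (v, k) | k in [set k | [&& allowed X v k, allowed Y v k & k != sval Y w]]].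
  have cZ : (2 * (q - Delta - 1) <= #|Z|)%N.
    rewrite cardsU (_ : _ :&: _ = set0) ?cards0 ?subn0; last first.
      apply/setP => -[x k]; rewrite !inE; apply/negP => /andP[].
      by case/imsetP => k1 _ [-> _] /imsetP[k2 _ [euv _]]; rewrite euv eqxx in uv.
    rewrite !card_imset; [|by move=> k1 k2 []..].
    have := card_both_allowed u (sval X w) XY; have := card_both_allowed v (sval Y w) XY.
    lia.
  have sub : A \subset concordant X Y w :\: Z.
    apply/subsetP => -[x k]; rewrite in_setD => /setIdP[xk /= /andP[c1 c2]].
    rewrite xk andbT; apply/negP => /setUP[] /imsetP[k']; rewrite inE => /and3P[_ _ nk] [ex ek].
      by move: c1; rewrite ex eqxx ek (negPf nk).
    by move: c2; rewrite ex eqxx ek (negPf nk).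
  have Zsub : Z \subset concordant X Y w.
    apply/subsetP => -[x k] /setUP[] /imsetP[k']; rewrite !inE /= => /and3P[aX aY _] [-> ->].
      by rewrite uw aX.
    by rewrite vw aX.
  have := subset_leq_card sub; rewrite cardsD (setIidPr Zsub).
  have := subset_leq_card Zsub; rewrite !muln1.
  by move: #|Z| cZ #|A| #|concordant X Y w| => z cZ a c; lia.
have sub : A \subset [set (u, sval X w); (v, sval Y w)].
  apply/subsetP => -[x k]; rewrite inE => /andP[_ /=].
  rewrite !inE !xpair_eqE (eq_sym x u) (eq_sym x v).
  case: (eqVneq u x) => [ux|_]; first by move=> /andP[->].
  case: (eqVneq v x) => [vx|_] /=; first by move=> /andP[_ ->].
  by rewrite (negPf nc).
have := subset_leq_card sub; rewrite cards2; case: (_ != _); lia.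
Qed.

Lemma crossed_drift :
  (\sum_(vk in concordant X Y w)
     #|crossed (glauber_step X vk.1 vk.2) (glauber_step Y vk.1 vk.2) w| +
   2 * (q - Delta - 1) * #|crossed X Y w| <=
   #|concordant X Y w| * #|crossed X Y w| + 4 * Delta)%N.
Proof.
have cE (A B : Omega) : #|crossed A B w| = (\sum_(p in links w) (p \in crossed A B w))%N.
  rewrite -sum1_card big_mkcond [RHS]big_mkcond; apply: eq_bigr => p _.
  by rewrite in_crossed; case: (p \in links w) => //=; case: (_ && _).
have := leq_sum (index_enum _) crossed_pair_drift; rewrite !big_split /= -!big_distrr /= -!cE.
rewrite exchange_big /=; under eq_bigr do rewrite -cE.
rewrite sum_nat_const; have := card_links w; move: #|links w| => l l_le h.
by apply: leq_trans h _; rewrite leq_add2l; lia.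
Qed.

(** The crossed pairs and their reversals are disjoint subsets of the link, which has at most
    [2 * Delta] pairs. *)
Lemma card_crossed_le : (#|crossed X Y w| <= Delta)%N.
Proof.
have : (#|crossed X Y w| + #|crossed X Y w| <= #|links w|)%N.
  rewrite -{2}(card_imset _ (inv_inj swap_pairK)) -cardsUI (_ : _ :&: _ = set0).
    rewrite cards0 addn0; apply/subset_leq_card/subUsetP; split.
      by apply/subsetP => p /setIdP[].
    by apply/subsetP => _ /imsetP[p /setIdP[lk _] ->]; rewrite links_swap.
  apply/setP => p; rewrite !inE; apply/negP => /andP[/and3P[_ /eqP e1 _]].
  case/imsetP => r /setIdP[_ /andP[_ /eqP e2]] ep; move: e1; rewrite ep /= e2 => e3.
  by move: XYw; rewrite e3 eqxx.
by have := card_links w; move: #|links w| #|crossed X Y w| => l c; lia.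
Qed.

End Pair.
End Geometry.

(* The arithmetic behind the constant 1.65: up to lower order terms, the claim
   is the inequality [150 D (D + N) + 100 D N <= (98 D + 149 N) q] for
   [0 <= N <= D], whose two endpoints need [q >= 1.54 D] and [q >= 1.62 D]. *)
Lemma contraction_arith (n q D N B d F C s S phi : nat) :
  (0 < n -> 40 < D -> 165 * D <= 100 * q -> N <= D -> phi = 2 * D + N ->
   d + B <= D + N -> F + B = q ->
   s + 2 * (q - D - 1) * N <= C * N + 4 * D ->
   S + phi * F + phi * C = n * q * phi + 3 * D * d + (2 * (C * D) + s) ->
   50 * S <= (50 * n - 1) * q * phi)%N.
Proof.
move=> n0 D40 Dq ND phiE dB FB drift E.
have [p qE] : exists p, q = (p + D + 1)%N by exists (q - D - 1)%N; lia.
have pE : (q - D - 1 = p)%N by rewrite qE; lia.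
rewrite pE in drift.
have h1 : (S + phi * F + 2 * p * N <= n * q * phi + 3 * D * d + 4 * D)%N.
  by rewrite phiE in E *; lia.
have h2 : (phi * F + phi * B = phi * q)%N by rewrite -mulnDr FB.
(* As [phi <= 3 * D], blocked colours cost no more than discordant moves, so the bound on [d + B]
   applies. *)
have h3 : (phi * B <= 3 * D * B)%N by rewrite leq_mul2r phiE; apply/orP; right; lia.
have h4 : (3 * D * (d + B) <= 3 * D * (D + N))%N by rewrite leq_mul2l dB orbT.
have h5 : (165 * (D * D) <= 100 * (q * D))%N by rewrite !mulnA leq_mul2r Dq orbT.
have h6 : (165 * (D * N) <= 100 * (q * N))%N by rewrite !mulnA leq_mul2r Dq orbT.
have h7 : (D * N <= D * D)%N by rewrite leq_mul2l ND orbT.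
(* With [q >= 1.65 D] and [N <= D] the slack is at least [7.55 D^2]; it must absorb
   [200 D + 100 N <= 300 D], hence the threshold 40. *)
have h8 : (41 * D <= D * D)%N by rewrite leq_mul2r D40 orbT.
have h9 : ((50 * n - 1) * q * phi + q * phi = 50 * (n * q * phi))%N.
  by rewrite -mulnDl -mulSnr subn1 prednK ?muln_gt0 // !mulnA.
have h10 : (q * N = p * N + D * N + N)%N by rewrite qE !mulnDl mul1n.
have h11 : (q * phi = 2 * (q * D) + q * N)%N by rewrite phiE; lia.
by move: h1 h2 h4 h9; rewrite !mulnDr; move: h3 h5 h6 h7 h8 h10 h11; lia.
Qed.

(** * One step of the chain contracts Lipschitz constants *)

Section Contraction.
Variables (R : realType) (V : finType) (H : hypergraph V) (q : nat).
Hypothesis H3 : uniform 3 H.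
Local Notation Omega := (proper_colouring H q).
Local Notation Delta := (max_degree H).
Implicit Types (X Y Z : Omega) (u v w : V) (k c : 'I_q) (f : Omega -> R).

(** Dual form of the path metric: only adjacent colourings are constrained, and exchanging [X] and
    [Y] gives the other sign. *)
Definition lipschitz (K : R) f := forall X Y w,
  agree_off X Y w -> sval X w != sval Y w -> f X - f Y <= K * (weight X Y w)%:R.

Lemma weight_bounds X Y w : agree_off X Y w -> sval X w != sval Y w ->
  (2 * Delta <= weight X Y w <= 3 * Delta)%N.
Proof. by move=> XY XYw; have := card_crossed_le H3 XYw; rewrite /weight; lia. Qed.

Lemma step_agree_off X v k : agree_off (glauber_step X v k) X v.
Proof.
move=> u uv; rewrite val_step; case: ifP => // _.
by rewrite ffunE (negPf uv).
Qed.

Lemma agree_offC X Y w : agree_off X Y w -> agree_off Y X w.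
Proof. by move=> h u uw; rewrite h. Qed.

(* Distance after the move [vk] of the identity coupling. A discordant move
   recolours only one side; the new disagreement is reached through [X] or [Y]
   itself, so that the path between the two sides stays proper. *)
Definition move_cost X Y w (vk : V * 'I_q) : nat :=
  if vk \in concordant X Y w then
    (2 * Delta + #|crossed (glauber_step X vk.1 vk.2) (glauber_step Y vk.1 vk.2) w|)%N
  else if (vk.1 == w) && allowed X w vk.2 then 0%N
  else (weight X Y w + 3 * Delta * (vk \in discordant X Y w))%N.

Lemma lipschitz_adjacent K f X Y w : lipschitz K f -> 0 <= K -> agree_off X Y w ->
  f X - f Y <= K * (3 * Delta)%:R.
Proof.
move=> Lf K0 XY; case: (eqVneq (sval X w) (sval Y w)) => [e|ne].
  have -> : X = Y.
    apply: val_inj; apply/ffunP => u /=.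
    by case: (eqVneq u w) => [->|uw]; [exact: e | exact: XY].
  by rewrite subrr mulr_ge0.
apply: le_trans (Lf X Y w XY ne) _; rewrite ler_wpM2l // ler_nat.
by have /andP[] := weight_bounds XY ne.
Qed.

Lemma move_costP K f X Y w v k : lipschitz K f -> 0 <= K ->
  agree_off X Y w -> sval X w != sval Y w ->
  f (glauber_step X v k) - f (glauber_step Y v k) <= K * (move_cost X Y w (v, k))%:R.
Proof.
move=> Lf K0 XY XYw; rewrite /move_cost /=.
case: ifP => [cc|].
  move: (cc); rewrite inE /= => /and3P[vw aX aY].
  apply: le_trans (Lf _ _ w _ _) _ => //.
    by move=> u uw; rewrite !step_allowed //; case: ifP => // _; apply: XY.
  by rewrite !step_allowed // !(eq_sym w) (negPf vw).
move: (agree_offC XY) => YX ncc.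
case: (eqVneq v w) ncc => [-> _|vw ncc] /=.
  (* An accepted recolouring of [w] makes the two chains coalesce, and both accept the same colours
     there. *)
  have e : recolour (sval X) w k = recolour (sval Y) w k.
    by apply/ffunP => u; rewrite !ffunE; case: eqVneq => // uw; apply: XY.
  have ea : allowed X w k = allowed Y w k by rewrite /allowed e.
  case: (boolP (allowed X w k)) => aX.
    have -> : glauber_step X w k = glauber_step Y w k.
      by apply: val_inj; rewrite /= !val_step -ea aX e.
    by rewrite subrr mulr0.
  rewrite !step_not_allowed -?ea //.
  by apply: le_trans (Lf X Y w XY XYw) _; rewrite ler_wpM2l // ler_nat leq_addr.
move: ncc; rewrite !inE /= vw /=.
case aX : (allowed X v k); case aY : (allowed Y v k) => //= _.
- rewrite (step_not_allowed (negbT aY)) muln1 natrD mulrDr.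
  rewrite -(subrKA (f X)) [leLHS]addrC lerD //; first exact: Lf.
  exact: lipschitz_adjacent (step_agree_off _ _).
- rewrite (step_not_allowed (negbT aX)) muln1 natrD mulrDr.
  rewrite -(subrKA (f Y)) lerD //; first exact: Lf.
  exact: (lipschitz_adjacent Lf K0 (agree_offC (@step_agree_off Y v k))).
- by rewrite !step_not_allowed ?aX ?aY // muln0 addn0; apply: Lf.
Qed.

Hypothesis Delta_large : (40 < Delta)%N.
Hypothesis q_large : 165 / 100 * Delta%:R <= q%:R :> R.

Lemma sum_move_cost X Y w : agree_off X Y w -> sval X w != sval Y w ->
  (50 * \sum_vk move_cost X Y w vk <= (50 * #|V| - 1) * q * weight X Y w)%N.
Proof.
move=> XY XYw; pose F : {set V * 'I_q} := [set (w, k) | k in [set k | allowed X w k]].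
(* Coalescing and concordant moves are compensated on the left, which avoids truncated
   subtraction. *)
have costE vk : (move_cost X Y w vk + weight X Y w * (vk \in F)
      + weight X Y w * (vk \in concordant X Y w) =
    weight X Y w + 3 * Delta * (vk \in discordant X Y w) +
    (if vk \in concordant X Y w then 2 * Delta +
      #|crossed (glauber_step X vk.1 vk.2) (glauber_step Y vk.1 vk.2) w| else 0))%N.
  have inF : (vk \in F) = (vk.1 == w) && allowed X w vk.2.
    case: vk => v k /=; apply/imsetP/andP => [[k' ak [-> ->]]|[/eqP-> ak]].
      by rewrite inE in ak.
    by exists k; rewrite ?inE.
  rewrite inF /move_cost !inE; case: vk {inF} => v k /=.
  case: (eqVneq v w) => [->|vw] /=; first by case: (allowed X w k); lia.
  by case: (allowed X v k); case: (allowed Y v k) => /=; lia.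
have wE : weight X Y w = (2 * Delta + #|crossed X Y w|)%N by [].
move: (weight X Y w) wE costE => phi wE costE.
have := @eq_bigr _ 0%N addn _ (index_enum _) predT _ _ (fun vk _ => costE vk).
rewrite !big_split /= -!big_distrr /= -!big_mkcond /= !big_split /= !sum_nat_const.
rewrite !muln1 card_prod card_ord.
have cF : (#|F| + #|[set k | ~~ allowed X w k]| = q)%N.
  rewrite card_imset => [|k1 k2 [] //].
  apply: etrans (_ : #|'I_q| = q); last exact: card_ord.
  rewrite -(cardsC [set k | allowed X w k]); congr (_ + _)%N.
  by apply: eq_card => k; rewrite !inE.
have Dq : (165 * Delta <= 100 * q)%N by rewrite -(ler_nat R) !natrM; move: q_large; lra.
have Nle := card_crossed_le H3 XYw.
have n0 : (0 < #|V|)%N by apply/card_gt0P; exists w.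
have := crossed_drift H3 XY XYw; have := discordant_blocked H3 XY XYw.
rewrite muln0 addn0 => dB drift E; apply: (contraction_arith n0 Delta_large Dq Nle wE dB cF drift).
by rewrite E addnn mul2n.
Qed.

(** The transition operator averaged over moves instead of target states, so that the identity
    coupling compares summands one by one. *)
Definition step_average f X : R :=
  (\sum_vk f (glauber_step X vk.1 vk.2)) / (#|V| * q)%:R.

Lemma lipschitz_step K f : 0 <= K -> lipschitz K f ->
  lipschitz (K * (1 - (50 * #|V|)%:R^-1)) (step_average f).
Proof.
move=> K0 Lf X Y w XY XYw.
have n0 : (0 < #|V|)%N by apply/card_gt0P; exists w.
have q0 : (0 < q)%N by have := ltn_ord (sval X w); lia.
have nq0 : 0 < (#|V| * q)%:R :> R by rewrite ltr0n muln_gt0 n0.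
rewrite /step_average -mulrBl ler_pdivrMr // -sumrB.
apply: le_trans (_ : \sum_vk K * (move_cost X Y w vk)%:R <= _).
  by apply: ler_sum => -[v k] _; apply: move_costP.
rewrite -mulr_sumr -!mulrA ler_wpM2l // -natr_sum.
have := sum_move_cost XY XYw; rewrite -(ler_nat R) => h.
have n0R : 0 < #|V|%:R :> R by rewrite ltr0n.
rewrite -(ler_pM2l (ltr0n R 50)) -natrM; apply: le_trans h _.
rewrite !natrM natrB ?muln_gt0 // natrM invfM.
rewrite le_eqVlt; apply/orP; left; apply/eqP; field.
by rewrite gt_eqF.
Qed.
End Contraction.

(** * Joining proper colourings by short proper paths *)

Section Connectivity.
Variables (R : realType) (V : finType) (H : hypergraph V) (q : nat).
Hypothesis H3 : uniform 3 H.
Local Notation Omega := (proper_colouring H q).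
Local Notation Delta := (max_degree H).
Hypothesis q_large : (Delta + 1 < q)%N.
Implicit Types (X Y Z : Omega) (u v w : V) (c : 'I_q).

Lemma allowed_other X u c : exists2 k, allowed X u k & k != c.
Proof.
have XX : agree_off X X u by [].
have /card_gt0P[k] : (0 < #|[set k | [&& allowed X u k, allowed X u k & k != c]]|)%N.
  by apply: leq_trans (card_both_allowed H3 u c XX); lia.
by rewrite inE => /and3P[ak _ kc]; exists k.
Qed.

Variables (f : Omega -> R) (d : R).
Hypothesis d_ge0 : 0 <= d.
Hypothesis f_adjacent : forall X Y w, agree_off X Y w -> f X - f Y <= d.

(** Vertices outside [S] of colour [c] are recoloured one at a time with an allowed colour other
    than [c]. The path is recorded only through the change of [f], at most [d] per move. *)
Lemma clear_colour (S : {set V}) c X : exists Y,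
  [/\ {in S, sval Y =1 sval X}, {in ~: S, forall u, sval Y u != c} &
      f X - f Y <= d * #|[set u | (u \notin S) && (sval X u == c)]|%:R].
Proof.
have [m] := ubnP #|[set u | (u \notin S) && (sval X u == c)]|.
elim: m X => // m IHm X; set U := [set u | _].
case: (set_0Vmem U) => [U0 _|[u uU] Um].
  exists X; split=> [//|u|]; last by rewrite subrr mulr_ge0.
  rewrite inE => uS; apply/negP => Xu.
  by have : u \in U; [rewrite inE uS | rewrite U0 inE].
have /andP[uS Xu] : (u \notin S) && (sval X u == c) by rewrite inE in uU.
have [k ak kc] := allowed_other X u c; pose X' := glauber_step X u k.
have sub : [set v | (v \notin S) && (sval X' v == c)] \subset U :\ u.
  apply/subsetP => v; rewrite !inE step_allowed //.
  by case: (eqVneq v u) => [->|] //=; rewrite (negPf kc) andbF.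
have cU : #|U| = #|U :\ u|.+1 by rewrite (cardsD1 u) uU.
have le1 := subset_leq_card sub.
have [|Y [YS YC fY]] := IHm X'; first by rewrite cU ltnS in Um; apply: leq_ltn_trans Um.
exists Y; split=> // [v vS|].
  rewrite YS // step_allowed //; case: eqVneq => // vu.
  by rewrite -vu vS in uS.
rewrite -(subrKA (f X')) cU -addn1 natrD mulrDr mulr1 addrC lerD //.
  by apply: le_trans fY _; rewrite ler_wpM2l // ler_nat.
exact: f_adjacent (agree_offC (@step_agree_off _ _ _ X u k)).
Qed.

(** First clear the colour [sval Y v] outside [S]. An edge then blocking it at [v] would have its
    other vertices in [S], and so would be monochromatic in [Y]. *)
Lemma extend_agreement (S : {set V}) v X Y : {in S, sval X =1 sval Y} -> v \notin S ->
  exists2 Z : Omega, {in v |: S, sval Z =1 sval Y} & f X - f Z <= d * (#|V| + 1)%:R.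
Proof.
move=> XY vS; have [X' [X'S X'C fX']] := clear_colour S (sval Y v) X.
have av : allowed X' v (sval Y v).
  apply/negPn/negP => /not_allowedP[e [eH ve eC]].
  apply: (@not_monochromatic _ _ _ Y e (sval Y v) eH) => y ye.
  case: (eqVneq y v) => [->//|yv]; have := eC y ye yv.
  case: (boolP (y \in S)) => yS; first by rewrite X'S // XY.
  by move/eqP; rewrite (negPf (X'C y _)) // inE.
exists (glauber_step X' v (sval Y v)).
  move=> u; rewrite step_allowed // => /setU1P[->|uS]; first by rewrite eqxx.
  by case: eqVneq => [->//|_]; rewrite X'S // XY.
rewrite -(subrKA (f X')) natrD mulrDr mulr1 lerD //.
  by apply: le_trans fX' _; rewrite ler_wpM2l // ler_nat max_card.
exact: f_adjacent (agree_offC (@step_agree_off _ _ _ X' v (sval Y v))).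
Qed.

(** One round of at most [#|V| + 1] recolourings for each vertex outside the agreement set. *)
Lemma oscillation_le X Y : f X - f Y <= d * (#|V| * (#|V| + 1))%:R.
Proof.
have step m (S : {set V}) Z : #|~: S| = m -> {in S, sval Z =1 sval Y} ->
    f Z - f Y <= d * (m * (#|V| + 1))%:R.
  elim: m S Z => [|m IHm] S Z cS ZY.
    have -> : Z = Y.
      apply: val_inj; apply/ffunP => u; apply: ZY; apply/negPn/negP => uS.
      by have := cards0_eq cS => /setP/(_ u); rewrite !inE uS.
    by rewrite subrr mul0n mulr0.
  have /card_gt0P[v] : (0 < #|~: S|)%N by rewrite cS.
  rewrite inE => vS; have [Z' Z'Y fZ'] := extend_agreement ZY vS.
  rewrite -(subrKA (f Z')) mulSn natrD mulrDr lerD //; apply: IHm Z'Y.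
  have -> : ~: (v |: S) = (~: S) :\ v by apply/setP => u; rewrite !inE negb_or.
  by have := cardsD1 v (~: S); rewrite inE vS cS => -[].
by apply: (step _ set0) => [|u]; rewrite ?setC0 ?cardsT ?inE.
Qed.
End Connectivity.

(** * Transition operators and total variation for finite chains *)

Section Chains.
Variables (R : realType) (S : finType) (P : S -> S -> R).

Definition transition (f : S -> R) (x : S) : R := \sum_y P x y * f y.

Lemma sum_step_prob t (f : S -> R) x :
  \sum_y step_prob P t x y * f y = iter t transition f x.
Proof.
elim: t x => [|t IHt] x.
  rewrite (bigD1 x) //= /step_prob expr0 mxE eqxx mul1r big1 ?addr0 // => y yx.
  by rewrite mxE (inj_eq enum_rank_inj) eq_sym (negPf yx) mul0r.
rewrite iterS /transition; under [RHS]eq_bigr do rewrite -IHt mulr_sumr.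
rewrite exchange_big; apply: eq_bigr => y _ /=.
rewrite /step_prob exprS mxE mulr_suml (reindex enum_rank) /=; last first.
  exact/onW_bij/enum_rank_bij.
by apply: eq_bigr => z _; rewrite mxE !enum_rankK mulrA.
Qed.

Hypothesis P_col : forall y, \sum_x P x y = 1.

(** Unit column sums make the uniform distribution stationary, so uniform averages are preserved. *)
Lemma sum_transition t (f : S -> R) : \sum_x iter t transition f x = \sum_x f x.
Proof.
elim: t => // t <-; rewrite iterS /transition exchange_big /=.
by apply: eq_bigr => y _; rewrite -mulr_suml P_col mul1r.
Qed.

(* Testing the difference of the two distributions against its sign. *)
Lemma worst_tv_dist_le t (b : R) : 0 <= b ->
  (forall f : S -> R, (forall x, `|f x| <= 1) ->
     forall x y, iter t transition f x - iter t transition f y <= b) ->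
  worst_tv_dist P (@uniform_dist R S) t <= b.
Proof.
move=> b0 osc; rewrite /worst_tv_dist.
elim/big_ind: _ => // [x y xb yb|x _]; first by rewrite ge_max xb.
pose s y := Num.sg (step_prob P t x y - uniform_dist R y).
have S0 : 0 < #|S|%:R :> R by rewrite ltr0n; apply/card_gt0P; exists x.
(* The uniform mean of [s] equals that of its iterate, so the sum is an average of differences of
   the iterated [s]. *)
have tvE : \sum_y `|step_prob P t x y - uniform_dist R y| =
    #|S|%:R^-1 * \sum_z (iter t transition s x - iter t transition s z).
  rewrite sumrB sum_transition sumr_const mulrBr -[X in _ * X - _]mulr_natl mulKf ?gt_eqF //.
  rewrite -sum_step_prob mulr_sumr -sumrB; apply: eq_bigr => y _.
  by rewrite normrEsg -/(s y) /uniform_dist mulrC mulrBl.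
have : \sum_z (iter t transition s x - iter t transition s z) <= \sum_(z : S) b.
  apply: ler_sum => z _; apply: osc => y; rewrite /s normr_sg.
  by case: (_ != _).
rewrite sumr_const -mulr_natl => le_b.
rewrite /tv_dist tvE; apply: (@le_trans _ _ (2^-1 * b)); last by lra.
rewrite ler_pM2l ?invr_gt0 // -(ler_pM2l S0) mulrA mulfV ?gt_eqF // mul1r.
exact: le_b.
Qed.
End Chains.

(** * Transition operator and symmetry of the Glauber chain *)

Section Glauber.
Variables (R : realType) (V : finType) (H : hypergraph V) (q : nat).
Local Notation Omega := (proper_colouring H q).

Lemma transition_glauber (f : Omega -> R) X :
  transition (@glauber R V H q) f X = step_average f X.
Proof.
rewrite /transition /step_average /glauber mulr_suml.
rewrite (partition_big (fun vk : V * 'I_q => glauber_step X vk.1 vk.2) predT) //=.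
apply: eq_bigr => Y _; under eq_bigr => vk /eqP-> do [].
rewrite sumr_const -[RHS]mulr_natl mulrAC -mulrA; congr (_%:R * _).
by apply: eq_card => vk; rewrite !inE.
Qed.

(** A move at [v] leading from [A] to a different [B] is undone by giving [v] back the colour
    [sval A v]; this matching of moves is injective because the new colour must be [sval B v]. *)
Lemma glauberC (X Y : Omega) : glauber R X Y = glauber R Y X.
Proof.
case: (eqVneq X Y) => [->//|XY]; congr (_%:R / _).
have half (A B : Omega) : A != B ->
    (#|[set vk : V * 'I_q | glauber_step A vk.1 vk.2 == B]| <=
     #|[set vk : V * 'I_q | glauber_step B vk.1 vk.2 == A]|)%N.
  move=> AB; pose g (vk : V * 'I_q) := (vk.1, sval A vk.1).
  have moved v k : glauber_step A v k == B -> allowed A v k /\ sval B v = k.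
    case: (boolP (allowed A v k)) => [a /eqP<-|/step_not_allowed->].
      by rewrite step_allowed // eqxx.
    by rewrite (negPf AB).
  rewrite -(@card_in_imset _ _ g).
    apply/subset_leq_card/subsetP => _ /imsetP[[v k] + ->]; rewrite !inE /= => AvkB.
    have [a Bv] := moved _ _ AvkB; move/eqP: AvkB => <-.
    have e : recolour (sval (glauber_step A v k)) v (sval A v) = sval A.
      apply/ffunP => u; rewrite ffunE step_allowed //.
      by case: eqVneq => // ->.
    apply/eqP/val_inj; rewrite /= val_step /allowed e.
    by case: ifP => // /negP[]; exact: (valP A).
  move=> [v k] [v' k']; rewrite !inE /= => /moved[_ <-] /moved[_ <-].
  by rewrite /g /= => -[-> _].
by apply/eqP; rewrite eqn_leq !half // eq_sym.
Qed.

Lemma glauber_row (X : Omega) : (0 < #|V| * q)%N -> \sum_Y glauber R X Y = 1.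
Proof.
move=> nq; have := transition_glauber (fun=> 1) X.
rewrite /transition; under eq_bigr do rewrite mulr1; move=> ->.
by rewrite /step_average sumr_const card_prod card_ord divff // pnatr_eq0 -lt0n.
Qed.

End Glauber.

(** * Geometric decay and the mixing time *)

Section Mixing.
Variables (R : realType) (V : finType) (H : hypergraph V) (q : nat).
Hypothesis H3 : uniform 3 H.
Local Notation Omega := (proper_colouring H q).
Local Notation Delta := (max_degree H).
Hypothesis Delta_large : (40 < Delta)%N.
Hypothesis q_large : 165 / 100 * Delta%:R <= q%:R :> R.

Let n : R := #|V|%:R.

Lemma vertices_gt0 : (0 < #|V|)%N.
Proof.
apply: contraTT Delta_large; rewrite -leqNgt leqn0 => /eqP/card0_eq V0.
by rewrite /max_degree big_pred0.
Qed.

Lemma colours_large : (Delta + 1 < q)%N.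
Proof.
have Dq : (165 * Delta <= 100 * q)%N by rewrite -(ler_nat R) !natrM; move: q_large; lra.
by move: Delta_large Dq; lia.
Qed.

(** Initially [f] oscillates by at most 2 while weights are at least [2 * Delta], which gives the
    constant [Delta%:R^-1]. *)
Lemma lipschitz_iter (f : Omega -> R) t : (forall X, `|f X| <= 1) ->
  lipschitz (Delta%:R^-1 * (1 - (50 * n)^-1) ^+ t) (iter t (transition (@glauber R V H q)) f).
Proof.
move=> f1.
have D0 : 0 < Delta%:R :> R by rewrite ltr0n; move: Delta_large; lia.
have n1 : 1 <= n by rewrite ler1n vertices_gt0.
have r0 : 0 <= 1 - (50 * n)^-1 by rewrite subr_ge0 invf_le1 //; lra.
elim: t => [|t IHt].
  move=> X Y w XY XYw; rewrite expr0 mulr1 /=.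
  have /andP[lo _] := weight_bounds H3 XY XYw.
  apply: (@le_trans _ _ 2).
    by have := f1 X; have := f1 Y; rewrite !ler_norml => /andP[? ?] /andP[? ?]; lra.
  by rewrite mulrC ler_pdivlMr // -natrM ler_nat.
have K0 : 0 <= Delta%:R^-1 * (1 - (50 * n)^-1) ^+ t :> R.
  by rewrite mulr_ge0 ?invr_ge0 ?exprn_ge0 // ltW.
have := lipschitz_step H3 Delta_large q_large K0 IHt.
rewrite natrM -/n -mulrA -exprSr => Lip X Y w XY XYw.
by rewrite iterS !transition_glauber; apply: Lip.
Qed.

(** Each of the [n * (n + 1)] recolourings has weight at most [3 * Delta], so [Delta] cancels. *)
Lemma worst_tv_dist_glauber t :
  worst_tv_dist (@glauber R V H q) (@uniform_dist R Omega) t <=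
  3 * n * (n + 1) * (1 - (50 * n)^-1) ^+ t.
Proof.
have D0 : 0 < Delta%:R :> R by rewrite ltr0n; move: Delta_large; lia.
have n1 : 1 <= n by rewrite ler1n vertices_gt0.
have r0 : 0 <= 1 - (50 * n)^-1 by rewrite subr_ge0 invf_le1 //; lra.
have n0 := vertices_gt0; have q0 := colours_large.
apply: worst_tv_dist_le.
- move=> Y; under eq_bigr do rewrite glauberC; apply: glauber_row.
  by rewrite muln_gt0 n0; lia.
- by rewrite mulr_ge0 ?exprn_ge0 //; nra.
move=> f f1 X Y; have Lip := lipschitz_iter t f1.
have K0 : 0 <= Delta%:R^-1 * (1 - (50 * n)^-1) ^+ t :> R.
  by rewrite mulr_ge0 ?invr_ge0 ?exprn_ge0 // ltW.
apply: le_trans (oscillation_le H3 q0 _ _ X Y) _.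
- exact: mulr_ge0 K0 (ler0n R (3 * Delta)).
- by move=> A B w AB; exact: (lipschitz_adjacent H3 Lip K0 AB).
rewrite !natrM natrD -/n le_eqVlt; apply/orP; left; apply/eqP; field.
by rewrite gt_eqF //; lra.
Qed.

Lemma worst_tv_dist_glauber_le eps t : 0 < eps ->
  50 * n * (3 * n * (n + 1) + ln (1 / eps)) <= t%:R ->
  worst_tv_dist (@glauber R V H q) (@uniform_dist R Omega) t <= eps.
Proof.
move=> eps0 tn; apply: le_trans (worst_tv_dist_glauber t) _.
have n1 : 1 <= n by rewrite ler1n vertices_gt0.
have r0 : 0 <= 1 - (50 * n)^-1 by rewrite subr_ge0 invf_le1 //; lra.
have -> : eps = expR (ln eps) by rewrite lnK.
(* Both factors are bounded by [1 + x <= expR x]; the crude bound on the first keeps [ln n] out of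
   the polynomial. *)
apply: (@le_trans _ _ (expR (3 * n * (n + 1)) * expR (- (50 * n)^-1) ^+ t)).
  apply: ler_pM; rewrite ?exprn_ge0 //; first by nra.
    by apply: le_trans (expR_ge1Dx _); lra.
  rewrite lerXn2r ?nnegrE ?expR_ge0 //.
  exact: expR_ge1Dx.
rewrite -expRM_natl -expRD ler_expR.
move: tn; rewrite div1r lnV ?posrE // => tn.
have : 3 * n * (n + 1) - ln eps <= t%:R / (50 * n).
  by rewrite ler_pdivlMr 1?mulrC //; lra.
by rewrite mulrN; lra.
Qed.

End Mixing.

Lemma mixing_time_le (R : realType) (S : finType) (P : S -> S -> R) (pi : S -> R) eps T :
  mixed_from P pi eps T -> exists2 tau, is_mixing_time P pi eps tau & (tau <= T)%N.
Proof.
move=> mT; have exT : exists t, `[< mixed_from P pi eps t >] by exists T; apply/asboolP.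
case: (ex_minnP exT) => tau /asboolP mtau minT; exists tau; last exact/minT/asboolP.
by split=> // t mt; apply/minT/asboolP.
Qed.

Theorem theorem5p3 (R : realType) :
  exists (Delta0 : nat) (p : {poly {poly R}}),
    forall (V : finType) (H : hypergraph V) (q : nat),
      uniform 3 H ->
      (Delta0 < max_degree H)%N ->
      (0 < q)%N ->
      165 / 100 * (max_degree H)%:R <= q%:R :> R ->
      forall eps : R, 0 < eps < 1 ->
        exists tau : nat,
          is_mixing_time (@glauber R V H q)
            (@uniform_dist R (proper_colouring H q)) eps tau /\
          tau%:R <= p.[(#|V|%:R)%:P].[ln (1 / eps)].
Proof.
(* The outer variable stands for [n], the inner one for [ln (1 / eps)]; the final 1 pays for
   rounding up to an integer time. *)
exists 40%N, ((50%:P)%:P * 'X * ((3%:P)%:P * 'X * ('X + 1) + ('X)%:P) + 1).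
move=> V H q H3 Delta_large _ q_large eps /andP[eps0 eps1].
set n : R := #|V|%:R; set L := ln (1 / eps).
pose B := 50 * n * (3 * n * (n + 1) + L).
have n0 : 0 <= n by rewrite ler0n.
have L0 : 0 <= L by rewrite ln_ge0 // ler_pdivlMr ?mul1r // ltW.
have B0 : 0 <= B by rewrite !mulr_ge0 ?addr_ge0 ?mulr_ge0 ?addr_ge0.
have [|tau mtau tauT] := @mixing_time_le _ _ (@glauber R V H q)
    (@uniform_dist R (proper_colouring H q)) eps (Num.truncn B).+1.
  move=> t Tt; apply: worst_tv_dist_glauber_le => //.
  apply: le_trans (ltW (truncnS_gt B)) _; by rewrite ler_nat.
exists tau; split=> //.
rewrite (_ : _.[_].[_] = B + 1); last by rewrite !(hornerE, hornerC) /B.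
apply: (@le_trans _ _ ((Num.truncn B).+1)%:R); first by rewrite ler_nat.
by rewrite -natr1 lerD2r; have /andP[] := truncn_itv B0.
Qed.
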